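(* Let $v^{(\ell)}_j$ ($\ell \ge 0$, $0 \le j \le 2^{\ell+1}-1$) be the rational numbers defined by $v^{(0)}_0 = 1$, $v^{(0)}_1 = 1$, and, for $\ell \ge 1$, $$v^{(\ell)}_0 = 1,\quad v^{(\ell)}_1 = 2,\quad v^{(\ell)}_{2j} = -\frac{v^{(\ell-1)}_j}{v^{(\ell)}_{2j-1}},\quad v^{(\ell)}_{2j+1} = 1 + (-1)^j - v^{(\ell)}_{2j}\qquad (1 \le j \le 2^\ell - 1).$$ For $\ell \ge 0$ let $g_\ell(z) = \frac{1}{z}\prod_{h=0}^{\ell}(1 - z^{-2^h}) \in \mathbb{Q}(z)$. Then, for every $\ell \ge 0$, $$g_\ell(z) = \cfrac{v^{(\ell)}_0}{z+1 + \cfrac{v^{(\ell)}_1}{z-1 + \cfrac{v^{(\ell)}_2}{z+1 + \cfrac{\ddots}{\ddots + \cfrac{v^{(\ell)}_{2^{\ell+1}-1}}{z-1}}}}},$$ where the $j$-th denominator (for $j = 0, 1, \ldots, 2^{\ell+1}-1$) is $z+1$ if $j$ is even and $z-1$ if $j$ is odd. Moreover, for every $\ell \ge 0$, all the partial quotients $a_i(z) \in \mathbb{Q}[z]$ in the continued fraction expansion $g_\ell(z) = [0; a_1(z), \ldots, a_m(z)] = \cfrac{1}{a_1(z) + \cfrac{1}{\ddots + \cfrac{1}{a_m(z)}}}$ are polynomials of degree one. *)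

(* Defs.v *)
From mathcomp Require Import all_boot all_order all_algebra.
Set Implicit Arguments.
Unset Strict Implicit.
Unset Printing Implicit Defensive.
Import GRing.Theory.
Local Open Scope ring_scope.

(* One level of the recursion: from [u] = (v^(l-1)_j)_j to (v^(l)_j)_j. *)
Fixpoint vnext (u : nat -> rat) (k : nat) : rat :=
  match k with
  | 0 => 1
  | 1 => 2
  | k'.+1 => if odd k then 1 + (-1) ^+ k./2 - vnext u k'
             else - (u k./2 / vnext u k')
  end.

(* [v l j] is v^(l)_j; it is meaningful only for j <= 2 ^ l.+1 - 1. *)
Fixpoint v (l : nat) : nat -> rat :=
  if l is l'.+1 then vnext (v l') else fun=> 1.

Lemma v00 : v 0 0 = 1. Proof. by []. Qed.
Lemma v01 : v 0 1 = 1. Proof. by []. Qed.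
Lemma vS0 l : v l.+1 0 = 1. Proof. by []. Qed.
Lemma vS1 l : v l.+1 1 = 2. Proof. by []. Qed.

Lemma vS_even l j : (0 < j)%N ->
  v l.+1 (2 * j)%N = - (v l j / v l.+1 (2 * j - 1)%N).
Proof.
case: j => // j _; rewrite mul2n doubleS subn1 /=.
by rewrite odd_double /= doubleK.
Qed.

Lemma vS_odd l j : (0 < j)%N ->
  v l.+1 (2 * j + 1)%N = 1 + (-1) ^+ j - v l.+1 (2 * j)%N.
Proof.
case: j => // j _; rewrite mul2n addn1 doubleS /=.
by rewrite odd_double /= uphalf_double.
Qed.

Notation Qz := {fraction {poly rat}}.

Definition Qz_const (c : rat) : Qz := tofrac c%:P.

Definition z : Qz := tofrac 'X.

Definition g (l : nat) : Qz := z^-1 * \prod_(h < l.+1) (1 - z ^- (2 ^ h)).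

(* The finite continued fraction b_0 / (c_0 + b_1 / (c_1 + ... + b_n / c_n))
   attached to the list of pairs (b_i, c_i). *)
Definition gencf (F : fieldType) (s : seq (F * F)) : F :=
  foldr (fun bc t => bc.1 / (bc.2 + t)) 0 s.

Definition den (j : nat) : Qz := if odd j then z - 1 else z + 1.

(* f = [a0; a_1, ..., a_m] with a = (a_1, ..., a_m). As usual for continued
   fractions over Q[z], the a_i with i >= 1 are required to be nonconstant;
   the expansion is then unique and no denominator vanishes in [gencf]. *)
Definition cf_expansion (f : Qz) (a0 : {poly rat}) (a : seq {poly rat}) : Prop :=
  (forall p, p \in a -> (1 < size p)%N) /\
  f = tofrac a0 + gencf [seq (1, tofrac p) | p : {poly rat} <- a].

(* Main.v *)
Require Import Defs.
From mathcomp Require Import all_boot all_order all_algebra.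
From mathcomp Require Import zify ring.
Import GRing.Theory.
Local Open Scope ring_scope.

(** Nonvanishing: in the recursion, v^(l)_j is a 2-adic unit except that it has
    valuation 1 at j = 1 and valuation -1 at j = 2^l and j = 2^l + 1 (l >= 1);
    this pattern reproduces itself from one level to the next.

    Identity: g_(l+1)(z) = (z - 1) g_l(z^2).  If t_j denotes the tail of the
    level l+1 fraction starting at v^(l+1)_j, and s_k the tail of the level l
    fraction in z^2 starting at v^(l)_k, then backward induction gives
    s_k = - t_(2k-1) t_(2k) for k >= 1, and then t_0 = (z - 1) s_0.

    Degrees: dividing out the nonzero constants v^(l)_j turns this fraction into
    a regular one with linear partial quotients, and the regular expansion is
    unique because every tail has negative degree. *)

(** * Nonvanishing of the coefficients by 2-adic valuation *)

(** The 2-adic units of [rat]; the fraction need not be reduced. *)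
Definition odd_fraction (x : rat) : Prop :=
  exists m n : int, [/\ odd `|m|, odd `|n| & x = m%:~R / n%:~R].

Lemma odd_intr_neq0 (n : int) : odd `|n| -> n%:~R != 0 :> rat.
Proof. by move=> on; rewrite intr_eq0; apply/eqP => n0; rewrite n0 in on. Qed.

Lemma odd_fraction_neq0 x : odd_fraction x -> x != 0.
Proof.
by case=> m [n [om on ->]]; rewrite mulf_neq0 ?invr_eq0 ?odd_intr_neq0.
Qed.

Lemma odd_fractionN x : odd_fraction x -> odd_fraction (- x).
Proof.
case=> m [n [om on ->]]; exists (- m), n; split=> //; first by rewrite abszN.
by rewrite rmorphN mulNr.
Qed.

Lemma odd_fraction_div x y :
  odd_fraction x -> odd_fraction y -> odd_fraction (x / y).
Proof.
case=> m [n [om on ->]] [m' [n' [om' on' ->]]].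
exists (m * n'), (n * m'); rewrite !abszM !oddM om on om' on'; split=> //.
by rewrite !rmorphM /= invf_div mulf_div.
Qed.

Lemma odd_fraction_even_sub (k : nat) x :
  odd_fraction x -> odd_fraction (2 * k%:R - x).
Proof.
case=> m [n [om on ->]]; exists (2 * k%:Z * n - m), n; split=> //; first by lia.
by rewrite rmorphB !rmorphM /= mulrBl mulfK ?odd_intr_neq0.
Qed.

Lemma v_mul_prev l k : (0 < k)%N -> v l.+1 (2 * k - 1) != 0 ->
  v l.+1 (2 * k - 1) * v l.+1 (2 * k) = - v l k.
Proof. by move=> k0 nz; rewrite vS_even // mulrN mulrCA mulfV ?mulr1. Qed.

Lemma v_add_next l k : (0 < k)%N ->
  v l.+1 (2 * k) + v l.+1 (2 * k + 1) = 1 + (-1) ^+ k.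
Proof. by move=> k0; rewrite vS_odd // addrC subrK. Qed.

(* Clears the denominator of v^(m+1)_(2k) and v^(m+1)_(2k+1) at the prime 2. *)
Definition scale2 (m k : nat) : rat := if k == (2 ^ m)%N then 2 else 1.

(** [k./2] is 2^m exactly when [k] or [k.-1] is 2^(m+1). So the scalings of the numerator and the
    denominator in the recursion combine into that of their quotient. *)
Lemma scale2_mul m k : (1 < k)%N ->
  scale2 m.+1 k * scale2 m.+1 k.-1 = scale2 m k./2.
Proof.
rewrite /scale2 expnS => k1.
do 3![case: eqP => ?]; rewrite ?mulr1 ?mul1r //; exfalso; lia.
Qed.

Lemma scale2_neq0 m k : scale2 m k != 0.
Proof. by rewrite /scale2; case: ifP. Qed.

(** The two entries add up to 0 or 2, still an even integer after scaling, and an even integer minus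
    a 2-adic unit is a unit. *)
Lemma odd_fraction_v_succ m k : (0 < k)%N ->
  odd_fraction (scale2 m k * v m.+1 (2 * k)) ->
  odd_fraction (scale2 m k * v m.+1 (2 * k + 1)).
Proof.
move=> k0 h; rewrite vS_odd // mulrBr.
suff [n ->] : exists n : nat, scale2 m k * (1 + (-1) ^+ k) = 2 * n%:R.
  exact: odd_fraction_even_sub.
rewrite /scale2 -signr_odd; case: ifP => _; case: (odd k).
- by exists 0%N.
- by exists 2%N.
- by exists 0%N.
- by exists 1%N.
Qed.

Lemma odd_fraction_v_half m j : (1 < j)%N ->
  odd_fraction (scale2 m j./2 * v m.+1 (2 * j./2)) ->
  odd_fraction (scale2 m j./2 * v m.+1 j).
Proof.
move=> j1; case oj: (odd j); last by rewrite mul2n halfK oj subn0.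
move/(odd_fraction_v_succ m j./2 ltac:(lia)).
by have -> : (2 * j./2 + 1 = j)%N by lia.
Qed.

(** Induction on the level, then on [k]: the recursion writes the entry as minus a quotient of an
    entry one level below by the preceding entry of the same level, both units after scaling. *)
Lemma odd_fraction_v_even m k : (0 < k < 2 ^ m.+1)%N ->
  odd_fraction (scale2 m k * v m.+1 (2 * k)).
Proof.
(* Level 1 only has [k = 1], where the scaled value is 2 times -1/2. *)
elim: m k => [|m IHm] k; first by case: k => [|[|k]] //= _; exists (-1), 1.
elim: k => [|[|k] IHk] // kb.
  (* For [k = 1] the entry is -2/2, and the scaling is 1. *)
  exists (-1), 1; split=> //; rewrite /scale2 expnS.
  by case: eqP => // ?; lia.
have prev : odd_fraction (scale2 m.+1 k.+1 * v m.+2 (2 * k.+1 + 1)).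
  by apply: odd_fraction_v_succ => //; apply: IHk; lia.
have low : odd_fraction (scale2 m k.+2./2 * v m.+1 k.+2).
  apply: odd_fraction_v_half => //; apply: IHm.
  by move: kb; rewrite [(2 ^ m.+2)%N]expnS; lia.
have := odd_fractionN _ (odd_fraction_div _ _ low prev).
rewrite vS_even // -(scale2_mul m k.+2) //.
have -> : (2 * k.+2 - 1 = 2 * k.+1 + 1)%N by lia.
set y := v m.+2 (2 * k.+1 + 1); set c := scale2 m.+1 k.+2.
rewrite [k.+2.-1]/= [c * scale2 _ _]mulrC -[_ * c * _]mulrA -mulf_div.
by rewrite mulfV ?scale2_neq0 // mul1r mulrN mulrA.
Qed.

Lemma v_neq0 l j : (j < 2 ^ l.+1)%N -> v l j != 0.
Proof.
(* Level 0 and the indices 0 and 1 are settled by their values 1 and 2; the value 2 is no 2-adic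
   unit. *)
case: l => [//|m]; case: j => [//|[//|j]] jb.
suff /odd_fraction_neq0 : odd_fraction (scale2 m j.+2./2 * v m.+1 j.+2).
  by rewrite mulf_eq0 negb_or => /andP[].
apply: odd_fraction_v_half => //; apply: odd_fraction_v_even.
by move: jb; rewrite [(2 ^ m.+2)%N]expnS; lia.
Qed.

(** * Fractions of negative degree and uniqueness of regular expansions *)

(** Negative degree, zero included; the strict inequality forces [d] to be nonzero. *)
Definition proper_fraction {R : idomainType} (x : {fraction {poly R}}) : Prop :=
  exists n d : {poly R}, (size n < size d)%N /\ x = tofrac n / tofrac d.

Lemma tofrac_neq0 {R : idomainType} (p : {poly R}) :
  (0 < size p)%N -> tofrac p != 0 :> {fraction {poly R}}.
Proof. by rewrite tofrac_eq0 size_poly_gt0. Qed.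

Lemma proper_fraction0 {R : idomainType} : @proper_fraction R 0.
Proof. by exists 0, 1; rewrite size_poly0 size_poly1 tofrac0 mul0r. Qed.

Lemma ltn_pred_add (a b c : nat) :
  (a < b)%N -> (0 < c)%N -> ((a + c).-1 < (b + c).-1)%N.
Proof. lia. Qed.

Lemma subf_div (F : fieldType) (a b c d : F) : b != 0 -> d != 0 ->
  a / b - c / d = (a * d - c * b) / (b * d).
Proof. by move=> b0 d0; rewrite -mulNr addf_div // mulNr. Qed.

Lemma proper_fraction_sub {R : idomainType} (x y : {fraction {poly R}}) :
  proper_fraction x -> proper_fraction y -> proper_fraction (x - y).
Proof.
move=> [n [d [nd ->]]] [n' [d' [nd' ->]]].
exists (n * d' - n' * d), (d * d').
have d0 : d != 0 by rewrite -size_poly_gt0; lia.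
have d'0 : d' != 0 by rewrite -size_poly_gt0; lia.
split; last first.
  have dz : tofrac d != 0 :> {fraction {poly R}} by rewrite tofrac_eq0.
  have d'z : tofrac d' != 0 :> {fraction {poly R}} by rewrite tofrac_eq0.
  by rewrite tofracB !tofracM (subf_div _ _ _ _ _ dz d'z).
apply: leq_ltn_trans (size_polyD _ _) _; rewrite size_polyN gtn_max.
rewrite (size_mul d0 d'0).
apply/andP; split; apply: leq_ltn_trans (size_polyMleq _ _) _.
  by apply: ltn_pred_add nd _; rewrite size_poly_gt0.
by rewrite (addnC (size d)); apply: ltn_pred_add nd' _; rewrite size_poly_gt0.
Qed.

Lemma proper_tofrac {R : idomainType} (p : {poly R}) :
  proper_fraction (tofrac p) -> p = 0.
Proof.
move=> [n [d [nd pE]]]; have d0 : d != 0 by rewrite -size_poly_gt0; lia.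
have nE : n = p * d.
  by apply/eqP; rewrite -tofrac_eq tofracM pE mulfVK // tofrac_eq0.
apply/eqP; apply: contraTT nd => p0; rewrite nE (size_mul p0 d0) -leqNgt.
by move: p0; rewrite -size_poly_gt0; case: (size p) => // k _; rewrite leq_addl.
Qed.

(** The difference [p - q] is both a polynomial and proper, hence zero. This recovers a partial
    quotient from the value of the fraction. *)
Lemma proper_fraction_eqD {R : idomainType} (p q : {poly R})
    (x y : {fraction {poly R}}) :
    proper_fraction x -> proper_fraction y ->
  tofrac p + x = tofrac q + y -> p = q /\ x = y.
Proof.
move=> px py e.
have pq : p = q.
  apply/eqP; rewrite -subr_eq0; apply/eqP/proper_tofrac.
  suff -> : tofrac (p - q) = y - x :> {fraction {poly R}}.
    exact: proper_fraction_sub.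
  by rewrite tofracB; apply/eqP; rewrite subr_eq addrAC eq_sym subr_eq e addrC.
by split=> //; move: e; rewrite pq => /addrI.
Qed.

Lemma tofracD_proper_neq0 {R : idomainType} (p : {poly R})
    (x : {fraction {poly R}}) :
  (0 < size p)%N -> proper_fraction x -> tofrac p + x != 0.
Proof.
move=> p0 px; apply/eqP => e.
have [] := @proper_fraction_eqD _ p 0 x 0 px proper_fraction0.
  by rewrite e tofrac0 addr0.
by move=> pz; rewrite pz size_poly0 in p0.
Qed.

(** With [x = n / d] the value is [b d / (p d + n)], and the degree of [p d] exceeds those of [d]
    and [n]. *)
Lemma proper_fraction_step {R : idomainType} (b : R) (p : {poly R})
    (x : {fraction {poly R}}) :
  (1 < size p)%N -> proper_fraction x ->
  proper_fraction (tofrac b%:P / (tofrac p + x)).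
Proof.
move=> p1 [n [d [nd ->]]].
have d0 : d != 0 by rewrite -size_poly_gt0; lia.
have p0 : p != 0 by rewrite -size_poly_gt0; lia.
exists (b%:P * d), (p * d + n); split.
  have sp : (size d < size (p * d)%R)%N.
    rewrite (size_mul p0 d0).
    by case: (size p) p1 => [|[|k]] // _; exact: leq_addl.
  rewrite size_polyDl ?(ltn_trans nd) //.
  by rewrite mul_polyC (leq_ltn_trans (size_scale_leq _ _)).
rewrite tofracD !tofracM.
have dz : tofrac d != 0 :> {fraction {poly R}} by rewrite tofrac_eq0.
by rewrite -{1}(mulfK dz (tofrac p)) -mulrDl invf_div mulrA.
Qed.

Lemma gencf_cons (F : fieldType) b c (s : seq (F * F)) :
  gencf ((b, c) :: s) = b / (c + gencf s).
Proof. by []. Qed.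

Lemma proper_gencf {R : idomainType} (s : seq (R * {poly R})) :
    (forall bp, bp \in s -> (1 < size bp.2)%N) ->
  proper_fraction (gencf [seq (tofrac bp.1%:P, tofrac bp.2) | bp <- s]).
Proof.
elim: s => [|[b p] s IHs] hs; first exact: proper_fraction0.
apply: proper_fraction_step; first by apply: (hs (b, p)); rewrite mem_head.
by apply: IHs => bp bps; apply: hs; rewrite inE bps orbT.
Qed.

Lemma proper_regular_gencf {R : idomainType} (a : seq {poly R}) :
    (forall p, p \in a -> (1 < size p)%N) ->
  proper_fraction (gencf [seq (1, tofrac p) | p : {poly R} <- a]).
Proof.
move=> ha; have := @proper_gencf _ [seq (1, p) | p <- a].
rewrite -map_comp; apply => _ /mapP[p pa ->]; exact: ha.
Qed.

Lemma regular_gencf_cons_neq0 {R : idomainType} (a : seq {poly R}) q :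
    (forall p, p \in q :: a -> (1 < size p)%N) ->
  gencf [seq (1, tofrac p) | p : {poly R} <- q :: a] != 0.
Proof.
move=> ha; rewrite map_cons gencf_cons mul1r invr_eq0 tofracD_proper_neq0 //.
  by rewrite ltnW // ha ?mem_head.
by apply: proper_regular_gencf => p pa; apply: ha; rewrite inE pa orbT.
Qed.

(** Inverting both values exposes the first partial quotients as polynomial parts and leaves equal
    proper tails. *)
Lemma regular_gencf_inj {R : idomainType} (a a' : seq {poly R}) :
    (forall p, p \in a -> (1 < size p)%N) ->
    (forall p, p \in a' -> (1 < size p)%N) ->
    gencf [seq (1, tofrac p) | p : {poly R} <- a]
      = gencf [seq (1, tofrac p) | p : {poly R} <- a'] ->
  a = a'.
Proof.
elim: a a' => [|p a IHa] [|p' a'] // ha ha'.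
- by move/esym/eqP; rewrite (negbTE (regular_gencf_cons_neq0 _ _ ha')).
- by move/eqP; rewrite (negbTE (regular_gencf_cons_neq0 _ _ ha)).
have hta q : q \in a -> (1 < size q)%N.
  by move=> qa; apply: ha; rewrite inE qa orbT.
have hta' q : q \in a' -> (1 < size q)%N.
  by move=> qa; apply: ha'; rewrite inE qa orbT.
rewrite !map_cons !gencf_cons !mul1r => /invr_inj/proper_fraction_eqD.
case=> [||-> /IHa -> //]; exact: proper_regular_gencf.
Qed.

(** * Normalizing constant numerators to 1 *)

Lemma Qz_constM a b : Qz_const (a * b) = Qz_const a * Qz_const b.
Proof. by rewrite /Qz_const polyCM tofracM. Qed.

Lemma Qz_const1 : Qz_const 1 = 1.
Proof. by rewrite /Qz_const polyC1 tofrac1. Qed.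

Lemma Qz_constV a : a != 0 -> Qz_const a^-1 = (Qz_const a)^-1.
Proof.
move=> a0; have nz : Qz_const a != 0 by rewrite tofrac_eq0 polyC_eq0.
by apply: (mulIf nz); rewrite (mulVf nz) -Qz_constM (mulVf a0) Qz_const1.
Qed.

(** The free factor [c] makes the induction work: dividing through by [c * b] rescales [p] and
    passes the factor [(c * b)^-1] on to the tail. *)
Lemma scaled_gencf_regular (s : seq (rat * {poly rat})) (c : rat) :
    c != 0 -> (forall bp, bp \in s -> bp.1 != 0 /\ size bp.2 = 2%N) ->
  exists2 a : seq {poly rat}, (forall p, p \in a -> size p = 2%N) &
    Qz_const c * gencf [seq (Qz_const bp.1, tofrac bp.2) | bp <- s]
      = gencf [seq (1, tofrac p) | p : {poly rat} <- a].
Proof.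
elim: s c => [|[b p] s IHs] c c0 hs.
  by exists [::] => //; rewrite mulr0.
have [b0 p2] : b != 0 /\ size p = 2%N by apply: (hs (b, p)); rewrite mem_head.
have cb0 : c * b != 0 by rewrite mulf_neq0.
have [||a ha ea] := IHs (c * b)^-1; first by rewrite invr_eq0.
  by move=> bp bps; apply: hs; rewrite inE bps orbT.
exists ((c * b)^-1 *: p :: a).
  by move=> q; rewrite inE => /predU1P[->|/ha //]; rewrite size_scale ?invr_eq0.
rewrite !map_cons !gencf_cons -ea -mul_polyC tofracM.
rewrite -/(Qz_const (c * b)^-1) -mulrDr.
by rewrite (Qz_constV _ cb0) Qz_constM mul1r invfM invrK mulrA.
Qed.

(** * Tails of the fractions and contraction of two levels *)

Definition cf_den (p : {poly rat}) (j : nat) : {poly rat} :=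
  if odd j then p - 1 else p + 1.

Lemma size_cf_den (p : {poly rat}) j :
  (1 < size p)%N -> size (cf_den p j) = size p.
Proof.
move=> p1; rewrite /cf_den.
by case: ifP => _; rewrite size_polyDl // ?size_polyN size_poly1.
Qed.

(* Taking an arbitrary polynomial p in place of z turns the substitution of z^2
   for z into p ^+ 2 for p. *)
Definition tail (l : nat) (p : {poly rat}) (j n : nat) : Qz :=
  gencf [seq (Qz_const (v l i), tofrac (cf_den p i)) | i <- iota j n].

Lemma tailS l (p : {poly rat}) j n : tail l p j n.+1 =
  Qz_const (v l j) / (tofrac (cf_den p j) + tail l p j.+1 n).
Proof. by []. Qed.

Lemma proper_tail l (p : {poly rat}) j n :
  (1 < size p)%N -> proper_fraction (tail l p j n).
Proof.
move=> p1; have := @proper_gencf rat [seq (v l i, cf_den p i) | i <- iota j n].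
rewrite -map_comp; apply => _ /mapP[i _ ->] /=; by rewrite size_cf_den.
Qed.

Lemma cf_den_tail_neq0 l (p : {poly rat}) i j n : (1 < size p)%N ->
  tofrac (cf_den p i) + tail l p j n != 0.
Proof.
move=> p1; apply: tofracD_proper_neq0; last exact: proper_tail.
by rewrite size_cf_den // ltnW.
Qed.

(** Here [t0], [t1], [t] stand for three consecutive tails of the upper level. The denominator on
    the left factors as [(x - 1 + t0) * (x + 1 + t1)], because [b + d = 1 + e]. *)
Lemma contraction_step (F : fieldType) (x a b d e u t : F) :
    let t1 := d / (x - 1 + t) in
    let t0 := b / (x + 1 + t1) in
    x - 1 + t != 0 -> x + 1 + t1 != 0 -> a * b = - u -> b + d = 1 + e ->
  u / (x ^+ 2 + e - t1 * t) = - (a / (x - 1 + t0) * t0).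
Proof.
move=> t1 t0 A0 B0 ab bd.
have t1E : t1 * (x - 1 + t) = d by rewrite mulfVK.
have t0E : t0 * (x + 1 + t1) = b by rewrite mulfVK.
have -> : x ^+ 2 + e - t1 * t = (x - 1 + t0) * (x + 1 + t1).
  have -> : e = b + d - 1 by rewrite bd; ring.
  by rewrite -{}t1E -{}t0E; ring.
by rewrite {2}/t0 mulf_div ab mulNr opprK.
Qed.

(** The analogue at the head of the fraction, where the coefficient 2 at index 1 lets [x - 1] split
    off. *)
Lemma contraction_init (F : fieldType) (x t1 t2 : F) :
    t1 * (x - 1 + t2) = 2 ->
  x ^+ 2 + 1 - t1 * t2 = (x - 1) * (x + 1 + t1).
Proof.
move=> t1E; have -> : x ^+ 2 + 1 - t1 * t2 = x ^+ 2 - 1 + 2 - t1 * t2 by ring.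
by rewrite -{}t1E; ring.
Qed.

Lemma cf_two_terms (F : fieldType) (x : F) : x != 0 -> x - 1 != 0 ->
  x^-1 * (1 - x^-1) = 1 / (x + 1 + 1 / (x - 1)).
Proof.
move=> x0 x1; have -> : x + 1 + 1 / (x - 1) = x ^+ 2 / (x - 1) by field.
by field; rewrite x0 x1.
Qed.

Lemma product_factor (F : fieldType) (x : F) : x != 0 ->
  x^-1 * (1 - x^-1) = (x - 1) * (x ^+ 2)^-1.
Proof. by move=> x0; field. Qed.

Lemma tofrac_cf_den_sqr (p : {poly rat}) k :
  tofrac (cf_den (p ^+ 2) k) = tofrac p ^+ 2 + Qz_const ((-1) ^+ k).
Proof.
rewrite /cf_den /Qz_const -tofracXn -tofracD -signr_odd.
by case: (odd k); rewrite ?expr1 ?expr0 ?polyCN polyC1.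
Qed.

Lemma tofrac_cf_den_even (p : {poly rat}) k :
  tofrac (cf_den p (2 * k)) = tofrac p + 1.
Proof. by rewrite /cf_den oddM tofracD tofrac1. Qed.

Lemma tofrac_cf_den_odd (p : {poly rat}) k :
  tofrac (cf_den p (2 * k).+1) = tofrac p - 1.
Proof. by rewrite /cf_den /= oddM tofracB tofrac1. Qed.

(** Induction on the number [n] of remaining terms at level [l]. Both tails on the right stop at
    index 2(k+n)-1, and for [n = 0] the tail at [2 * k] is empty. *)
Lemma tail_contraction l (p : {poly rat}) k n :
    (1 < size p)%N -> (0 < k)%N -> (k + n <= 2 ^ l.+1)%N ->
  tail l (p ^+ 2) k n =
    - (tail l.+1 p (2 * k - 1) (2 * n).+1 * tail l.+1 p (2 * k) (2 * n)).
Proof.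
move=> p1; elim: n k => [|n IHn] k k0 kn.
  by rewrite muln0 [tail l.+1 p (2 * k) 0]/tail mulr0 oppr0.
have -> : (2 * n.+1 = (2 * n).+2)%N by lia.
(* This form of the index shows it to be odd, which selects the denominator [p - 1]. *)
have [k' kE] : exists k', (2 * k - 1 = (2 * k').+1)%N by exists k.-1; lia.
rewrite [LHS]tailS (IHn k.+1) //; last by lia.
rewrite [tail l.+1 p (2 * k - 1) _]tailS.
have -> : ((2 * k - 1).+1 = 2 * k)%N by lia.
have -> : (2 * k.+1 - 1 = (2 * k).+1)%N by lia.
have -> : (2 * k.+1 = (2 * k).+2)%N by lia.
have ab : Qz_const (v l.+1 (2 * k - 1)) * Qz_const (v l.+1 (2 * k)) =
    - Qz_const (v l k).
  rewrite -Qz_constM v_mul_prev ?v_neq0 //; last by rewrite expnS; lia.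
  by rewrite /Qz_const polyCN tofracN.
have bd : Qz_const (v l.+1 (2 * k)) + Qz_const (v l.+1 (2 * k).+1) =
    1 + Qz_const ((-1) ^+ k).
  have := congr1 Qz_const (v_add_next l k k0).
  by rewrite addn1 /Qz_const !polyCD !tofracD polyC1 tofrac1.
have A0 := cf_den_tail_neq0 l.+1 p (2 * k).+1 (2 * k).+2 (2 * n) p1.
have B0 := cf_den_tail_neq0 l.+1 p (2 * k) (2 * k).+1 (2 * n).+1 p1.
rewrite [tail l.+1 p (2 * k) _]tailS [tail l.+1 p (2 * k).+1 _]tailS in B0 *.
rewrite kE tofrac_cf_den_odd tofrac_cf_den_even tofrac_cf_den_odd -kE
  tofrac_cf_den_sqr in A0 B0 *.
exact: (contraction_step _ _ _ _ _ _ _ _ A0 B0 ab bd).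
Qed.

Lemma tail_double l (p : {poly rat}) : (1 < size p)%N ->
  tail l.+1 p 0 (2 ^ l.+2) = (tofrac p - 1) * tail l (p ^+ 2) 0 (2 ^ l.+1).
Proof.
move=> p1; have [n nE] : exists n, (2 ^ l.+1 = n.+1)%N.
  by exists (2 ^ l.+1).-1; rewrite prednK ?expn_gt0.
have -> : (2 ^ l.+2 = (2 * n).+2)%N by rewrite expnS nE; lia.
rewrite nE [LHS]tailS [tail l _ 0 _]tailS tail_contraction //; last first.
  by rewrite nE.
have A0 := cf_den_tail_neq0 l.+1 p 1 2 (2 * n) p1.
have t1E :
    tail l.+1 p 1 (2 * n).+1 * (tofrac p - 1 + tail l.+1 p 2 (2 * n)) = 2.
  rewrite tailS -(tofrac_cf_den_odd p 0) mulfVK //.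
  by rewrite /Qz_const vS1 !rmorph_nat.
have x0 : tofrac p - 1 != 0 :> Qz.
  by rewrite -(tofrac_cf_den_odd p 0) tofrac_neq0 // size_cf_den // ltnW.
rewrite [(2 * 1 - 1)%N]/= tofrac_cf_den_sqr (tofrac_cf_den_even p 0).
set t1 := tail l.+1 p 1 _ in t1E *; set t2 := tail _ _ _ _ in t1E *.
have -> : v l.+1 0 = 1 by [].
have -> : v l 0 = 1 by case: (l).
rewrite expr0 Qz_const1 !mul1r.
by rewrite (contraction_init _ _ _ _ t1E) invfM mulVKf.
Qed.

(** * The product formula and the conclusion *)

(** The induction needs all [p] at once, as it passes from [p] to [p ^+ 2]: the factor at [h = 0]
    yields [p - 1] and the new prefactor, the others shift by one. *)
Lemma product_eq_tail l (p : {poly rat}) : (1 < size p)%N ->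
  (tofrac p)^-1 * \prod_(h < l.+1) (1 - tofrac p ^- (2 ^ h)) =
    tail l p 0 (2 ^ l.+1) :> Qz.
Proof.
elim: l p => [|l IHl] p p1.
  rewrite big_ord1 expn0 expr1 [RHS]tailS tailS addr0 (tofrac_cf_den_odd p 0).
  have x1 : tofrac p - 1 != 0 :> Qz.
    by rewrite -(tofrac_cf_den_odd p 0) tofrac_neq0 // size_cf_den // ltnW.
  have x0 : tofrac p != 0 :> Qz by rewrite tofrac_neq0 // ltnW.
  rewrite (tofrac_cf_den_even p 0) Qz_const1.
  exact: (cf_two_terms _ _ x0 x1).
have x0 : tofrac p != 0 :> Qz by rewrite tofrac_neq0 // ltnW.
have p2 : (1 < size (p ^+ 2))%N.
  have pz : p != 0 by rewrite -size_poly_gt0 ltnW.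
  rewrite expr2 (size_mul pz pz).
  by case: (size p) p1 => [|[|k]]; rewrite ?addnS.
rewrite tail_double // -IHl // big_ord_recl expn0 expr1 tofracXn.
under eq_bigr => i _ do rewrite lift0 expnS exprM.
rewrite !mulrA; congr (_ * _).
exact: (product_factor _ _ x0).
Qed.

Theorem theorem2p2 (l : nat) :
  [/\ (* the recursion defining v^(l) never divides by zero *)
      (forall j : nat, (1 <= j <= 2 ^ l - 1)%N -> v l (2 * j - 1) != 0),
      g l = gencf (mkseq (fun j => (Qz_const (v l j), den j)) (2 ^ l.+1)),
      (exists a : seq {poly rat}, cf_expansion (g l) 0 a)
    & (forall a : seq {poly rat}, cf_expansion (g l) 0 a ->
        forall p, p \in a -> size p = 2%N)].
Proof.
have gE : g l = tail l 'X 0 (2 ^ l.+1).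
  by rewrite -product_eq_tail ?size_polyX.
pose s := [seq (v l j, cf_den 'X j) | j <- iota 0 (2 ^ l.+1)].
have [|a ha ea] := @scaled_gencf_regular s 1 (oner_neq0 _).
  move=> bp /mapP[j]; rewrite mem_iota => jb ->.
  by rewrite v_neq0 // size_cf_den size_polyX.
have ha1 p : p \in a -> (1 < size p)%N by move/ha => ->.
have cfa : cf_expansion (g l) 0 a.
  split=> //; rewrite gE -ea /s -map_comp Qz_const1 mul1r.
  by rewrite tofrac0 add0r.
split.
- by move=> j jb; apply: v_neq0; rewrite expnS; lia.
- rewrite gE /tail /mkseq; congr gencf; apply: eq_map => j; congr pair.
  by rewrite /den /cf_den; case: ifP; rewrite ?tofracB ?tofracD tofrac1.
- by exists a.
(* By uniqueness any expansion is the one built from the coefficients, whose partial quotients are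
   linear. *)
move=> a' [ha' ga'] p; suff -> : a' = a by exact: ha.
apply: regular_gencf_inj => //.
by have [_] := cfa; rewrite ga' => /addrI.
Qed.
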